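(* Let $\eta$ be an $\mathbb{N}$-valued random variable with $\mathbf{P}[\eta\ge 1]>0$. If $\mathbf{E}\log(\eta\vee 1)<\infty$, then $p_c(\mathbb{Z},\eta)=1$.
   Context: Here $a\vee b=\max\{a,b\}$, $\mathbb{N}=\{0,1,2,\dots\}$, and $\mathbb{Z}$ denotes the graph with vertex set $\mathbb{Z}$ and edges between integers at distance $1$, with root $\mathbf{0}=0$. Frog model $\mathrm{FM}(\mathcal{G},p,\eta)$. Let $\mathcal{G}$ be an infinite connected undirected graph all of whose sites (vertices) have finite degree, with a fixed site $\mathbf{0}$ called the root; let $p\in[0,1]$ and let $\eta$ be a random variable with values in $\mathbb{N}$. Let $\{\eta(x)\}_{x}$, $\{(S^x_n(i))_{n\in\mathbb{N}}\}_{x,\,i\ge1}$, $\{\Xi^x_p(i)\}_{x,\,i\ge 1}$ be independent families of independent random variables, where $\eta(x)$ has the law of $\eta$, $(S^x_n(i))_n$ is a discrete-time simple random walk on $\mathcal{G}$ started from $x$, and $\mathbf{P}[\Xi^x_p(i)=k]=(1-p)p^{k-1}$, $k=1,2,\dots$ (for $p=1$, $\Xi^x_p(i)=\infty$, no death). Site $x$ initially contains $\eta(x)$ particles; at time $0$ all particles are sleeping except those at the root, which are active. If the particles of site $x$ are activated at time $T(x)$, the $i$-th of them ($1\le i\le\eta(x)$) is active and located at $S^x_n(i)$ at time $T(x)+n$ for $0\le n<\Xi^x_p(i)$, and then disappears. When an active particle visits a site, all sleeping particles there become active. Formally, $t(x,y)=\min_{1\le i\le\eta(x)}\min\{n<\Xi^x_p(i):S^x_n(i)=y\}$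 for $x\ne y$ ($\infty$ if there is no such $n$), and $T(x)=\inf\{t(x_0,x_1)+\dots+t(x_{m-1},x_m)\}$ over all finite sequences $\mathbf{0}=x_0,x_1,\dots,x_m=x$, with $T(\mathbf{0})=0$; $T(x)=\infty$ means that $x$ is never visited by active particles. The model survives if at every time there is at least one active particle; otherwise it dies out. The critical parameter is $p_c(\mathcal{G},\eta)=\inf\{p\in[0,1]:\mathbf{P}[\mathrm{FM}(\mathcal{G},p,\eta)\text{ survives}]>0\}$. *)

(* Defs.v *)
From HB Require Import structures.
From mathcomp Require Import all_boot all_order all_algebra.
From mathcomp Require Import all_classical all_reals all_analysis.

Set Implicit Arguments.
Unset Strict Implicit.
Unset Printing Implicit Defensive.

Import Order.TTheory GRing.Theory Num.Theory.
Local Open Scope classical_set_scope.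
Local Open Scope ring_scope.

(* Infinite connected undirected graphs with finite degrees and a root; the
   edges are given by duplicate-free lists of neighbours.  Such a graph has
   countably many vertices, so asking for a [countType] loses nothing. *)
Record graph := Graph {
  vertex :> countType;
  nbrs : vertex -> seq vertex;
  graph_root : vertex;
  nbrs_uniq : forall x, uniq (nbrs x);
  nbrs_sym : forall x y, (y \in nbrs x) = (x \in nbrs y);
  graph_connected : forall x y,
    exists2 s, path (fun u v => v \in nbrs u) x s & last x s = y;
  graph_infinite : infinite_set [set: vertex]
}.

Definition Z_nbrs (z : int) : seq int := [:: z - 1; z + 1].

Lemma Z_nbrs_uniq z : uniq (Z_nbrs z).
Proof.
rewrite /Z_nbrs /= inE andbT; apply/eqP => /addrI h.
by have : (-1 : int) == 1 by apply/eqP.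
Qed.

Lemma Z_nbrs_sym x y : (y \in Z_nbrs x) = (x \in Z_nbrs y).
Proof.
rewrite !inE orbC; congr (_ || _).
  by rewrite [RHS]eq_sym subr_eq.
by rewrite [LHS]eq_sym subr_eq.
Qed.

Lemma Z_connected (x y : int) :
  exists2 s, path (fun u v => v \in Z_nbrs u) x s & last x s = y.
Proof.
pose c (a b : int) :=
  exists2 s, path (fun u v => v \in Z_nbrs u) a s & last a s = b.
have cS a b b' : c a b -> b' \in Z_nbrs b -> c a b'.
  move=> [s ps ls] hb; exists (rcons s b'); last by rewrite last_rcons.
  by rewrite rcons_path ps ls.
have cD a n : c a (a + n%:Z) /\ c a (a - n%:Z).
  elim: n => [|n [IH1 IH2]]; first by split; exists [::]; rewrite //= ?subr0 ?addr0.
  split; first by apply: (cS _ _ _ IH1); rewrite !inE intS addrCA addrC eqxx orbT.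
  by apply: (cS _ _ _ IH2); rewrite !inE intS opprD addrCA [-1 + _]addrC eqxx.
have := cD x `|y - x|%N.
case: (lerP 0 (y - x)) => h [h1 h2].
  by move: h1; rewrite gez0_abs// [x + _]addrC subrK.
by move: h2; rewrite ltz0_abs// opprK [x + _]addrC subrK.
Qed.

Lemma Z_infinite : infinite_set [set: int].
Proof.
move=> fin; apply: infinite_nat.
have -> : [set: nat] = Posz @^-1` [set: int] by apply/seteqP.
by apply: finite_preimage fin => a b _ _ [].
Qed.

Definition Z_graph : graph :=
  Graph 0 Z_nbrs_uniq Z_nbrs_sym Z_connected Z_infinite.

Section frog_model.
Context (R : realType) (G : graph).

Section probabilistic_notions.
Context d (Omega : measurableType d) (P : probability Omega R).

(* Measurability of a map into a countable set of values. *)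
Definition discrete_measurable (A : Type) (X : Omega -> A) :=
  forall a, measurable (X @^-1` [set a]).

(* The sigma-algebra generated by a family of maps into countable sets. *)
Definition sigma_of (J A : Type) (X : J -> Omega -> A) : set (set Omega) :=
  <<s [set E | exists j a, E = X j @^-1` [set a]] >>.

Definition mutually_independent (I : eqType) (F : I -> set (set Omega)) :=
  forall (J : seq I) (E : I -> set Omega), uniq J ->
    (forall i, i \in J -> F i (E i)) ->
    P (\bigcap_(i in [set` J]) E i) = (\prod_(i <- J) P (E i))%E.

(* Simple random walk started from [x], through its finite-dimensional
   distributions. *)
Definition simple_random_walk (x : G) (S : nat -> Omega -> G) :=
  (forall n, discrete_measurable (S n)) /\
  forall (n : nat) (v : nat -> G),
    P [set w | forall k, (k <= n)%N -> S k w = v k] =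
    (if v 0%N == x then
       \prod_(k < n) (if v k.+1 \in nbrs (v k)
                      then (size (nbrs (v k)))%:R^-1 else 0)
     else 0)%:E.

(* [None] stands for an infinite lifetime. *)
Definition geometric_lifetime (p : R) (Xi : Omega -> option nat) :=
  [/\ discrete_measurable Xi,
      forall k, P (Xi @^-1` [set Some k.+1]) = ((1 - p) * p ^+ k)%:E &
      P (Xi @^-1` [set None]) = (if p == 1 then 1 else 0)%:E].

End probabilistic_notions.

(* A realization of FM(G, p, eta).  The particles of each site are numbered
   from 0, so those of [x] are the [i < fm_count x w]. *)
Record frog_model (p : {i01 R}) d0 (T0 : measurableType d0)
    (Q : probability T0 R) (eta : {RV Q >-> nat}) := FrogModel {
  fm_display : measure_display;
  fm_space : measurableType fm_display;
  fm_prob : probability fm_space R;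
  fm_count : G -> {RV fm_prob >-> nat};
  fm_walk : G -> nat -> nat -> fm_space -> G; (* site, particle, time *)
  fm_life : G -> nat -> fm_space -> option nat;
  fm_countP : forall x A, measurable A ->
    distribution fm_prob (fm_count x) A = distribution Q eta A;
  fm_walkP : forall x i, simple_random_walk fm_prob x (fm_walk x i);
  fm_lifeP : forall x i, geometric_lifetime fm_prob p%:num (fm_life x i);
  fm_indep : mutually_independent fm_prob
    (fun s : G + (G * nat) + (G * nat) =>
       match s with
       | inl (inl x) => sigma_of (fun _ : unit => fm_count x : _ -> nat)
       | inl (inr (x, i)) => sigma_of (fm_walk x i)
       | inr (x, i) => sigma_of (fun _ : unit => fm_life x i)
       end)
}.

#[global] Arguments fm_count {p d0 T0 Q eta} F x : rename.
#[global] Arguments fm_walk {p d0 T0 Q eta} F x i n w : rename.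
#[global] Arguments fm_life {p d0 T0 Q eta} F x i w : rename.

Definition alive (n : nat) (xi : option nat) : bool :=
  if xi is Some k then (n < k)%N else true.

Section dynamics.
Context (p : {i01 R}) d0 (T0 : measurableType d0) (Q : probability T0 R).
Context (eta : {RV Q >-> nat}) (F : frog_model p eta).
Implicit Types (w : fm_space F) (x y : G).

(* [t(x, y)]; the infimum of the empty set in [\bar R] is [+oo].  The diagonal
   values [t(x, x) >= 0] do not affect the infimum defining [T]. *)
Definition hitting_time w x y : \bar R :=
  ereal_inf [set (n%:R : R)%:E | n in
    [set n | exists i, [/\ (i < fm_count F x w)%N,
                           alive n (fm_life F x i w) &
                           fm_walk F x i n w = y]]].

(* [T(x)]: the infimum of [t(x_0,x_1) + ... + t(x_{m-1},x_m)] over the sequences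
   [s = x_1, ..., x_m] such that [x_0 = graph_root G] and [x_m = x] ([m = 0] allowed). *)
Definition activation_time w x : \bar R :=
  ereal_inf [set (\sum_(u <- pairmap (hitting_time w) (graph_root G) s) u)%E |
             s in [set s | last (graph_root G) s = x]].

Definition active_at w (n : nat) x (i : nat) : Prop :=
  (i < fm_count F x w)%N /\
  exists m, [/\ activation_time w x = (m%:R : R)%:E, (m <= n)%N &
                alive (n - m) (fm_life F x i w)].

Definition survives : set (fm_space F) :=
  [set w | forall n, exists x i, active_at w n x i].

End dynamics.

Definition critical_parameter d0 (T0 : measurableType d0)
    (Q : probability T0 R) (eta : {RV Q >-> nat})
    (FM : forall p : {i01 R}, frog_model p eta) : R :=
  inf [set p%:num | p in
    [set p : {i01 R} | (0 < fm_prob (FM p) (survives (F := FM p)))%E]].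

End frog_model.

(* Main.v *)
(* Call a site k-quiet when none of its particles lives longer than k steps,
   whatever paths they follow. For p < 1 a site fails to be k-quiet with
   probability at most q_k, where sum q_k < oo because E log (eta \/ 1) < oo;
   moreover, for k >= 1, a site is k-quiet with probability bounded away from
   0. If every site of an interval around the root is quiet for its distance
   to the complement (a barrier), then no particle leaves the interval and the
   process dies out. Up to long jumps, whose probability is controlled by the
   tail of sum q_k, the barriers at radius g, 2g, 3g, ... depend on disjoint
   sets of sites, and each is present with probability at least a constant
   independent of g, by convergence of prod (1 - q_k). So some barrier is
   present almost surely. *)
Require Import Defs.
From HB Require Import structures.
From mathcomp Require Import all_boot all_order all_algebra.
From mathcomp Require Import all_classical all_reals all_analysis.
From mathcomp Require Import measurable_realfun.
From mathcomp Require Import zify ring lra.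
Import Order.TTheory GRing.Theory Num.Theory.
Local Open Scope classical_set_scope.
Local Open Scope ring_scope.

(** * Independence of generated sigma-algebras *)

Lemma bigcap_eqseq (I : eqType) T (s : seq I) (f : I -> set T) :
  \bigcap_(i in [set` s]) f i = \big[setI/setT]_(i <- s) f i.
Proof.
elim: s => [|i s IH]; first by rewrite set_nil bigcap_set0 big_nil.
rewrite big_cons -IH; apply/seteqP; split => w.
  by move=> h; split => [|j /= js]; apply: h; rewrite /= inE ?eqxx// js orbT.
by move=> [wi ws] j /=; rewrite inE => /orP[/eqP ->//|]; exact: ws.
Qed.

Lemma sigma_algebra_setI (T : pointedType) (F : set (set T)) :
  sigma_algebra setT F -> setI_closed F.
Proof.
move=> sF A B; rewrite -(sigma_algebra_id sF) => FA FB.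
exact: (@measurableI _ (g_sigma_algebraType F)).
Qed.

Section independence.
Context {R : realType} {d : measure_display} {Omega : measurableType d}.
Variable P : probability Omega R.

(** Dynkin's argument: for fixed [H] the measurable sets obeying the product rule with [H] form a
    Dynkin system, and it contains the pi-system [G]. *)
Lemma product_rule_sigma (G : set (set Omega)) (H : set Omega) :
  G `<=` measurable -> setI_closed G -> measurable H ->
  (forall B, G B -> P (B `&` H) = (P B * P H)%E) ->
  forall A, <<s G >> A -> P (A `&` H) = (P A * P H)%E.
Proof.
move=> Gm GI mH GH.
have mG A : <<s G >> A -> measurable A.
  by move=> sA; apply: sA; split; [exact: sigma_algebra_measurable|exact: Gm].
suff: <<s G >> `<=` [set A | measurable A /\ P (A `&` H) = (P A * P H)%E].
  by move=> sub A /sub[].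
apply: lambda_system_subset => //; last by move=> A GA; split; [exact: Gm|exact: GH].
apply/dynkin_lambda_system; split.
- by split; rewrite ?setTI ?probability_setT ?mul1e.
- move=> A [mA AH]; split; first exact: measurableC.
  have fA : P A \is a fin_num by exact: fin_num_measure.
  have fH : P H \is a fin_num by exact: fin_num_measure.
  have /= := measureDI P mH mA; rewrite setDE.
  rewrite (setIC H (~` A)) (setIC H A) AH.
  rewrite probability_setC// => PH.
  have fAC : P (~` A `&` H) \is a fin_num.
    by apply: fin_num_measure; apply: measurableI => //; exact: measurableC.
  move: fA fH fAC PH; case: (P A) => [a| |]//; case: (P H) => [h| |]//.
  case: (P (~` A `&` H)) => [b| |]// _ _ _ [] hE.
  by rewrite -EFinB -EFinM mulrBl mul1r {1}hE addrK.
- move=> F tF FH; have mF n : measurable (F n) by case: (FH n).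
  split; first exact: bigcupT_measurable.
  rewrite setI_bigcupl measure_bigcup//=; last 2 first.
    by move=> n _; exact: measurableI.
    by under eq_fun do rewrite setIC; exact: trivIset_setIl.
  rewrite measure_bigcup//=.
  have [h hE] : exists h, P H = h%:E.
    by exists (fine (P H)); rewrite fineK// fin_num_measure.
  rewrite muleC hE -nneseriesZl//; apply: eq_eseriesr => n _.
  by rewrite (FH n).2 hE muleC.
Qed.

Lemma mutually_independentS (I : eqType) (F F' : I -> set (set Omega)) :
  (forall i, F' i `<=` F i) -> mutually_independent P F ->
  mutually_independent P F'.
Proof. by move=> sub ind J E uJ EJ; apply: ind => // i /EJ /sub. Qed.

Lemma mutually_independent_sigma (I : eqType) (F : I -> set (set Omega)) :
  (forall i, F i `<=` measurable) -> (forall i, setI_closed (F i)) ->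
  mutually_independent P F -> mutually_independent P (fun i => <<s F i >>).
Proof.
move=> Fm FI ind.
have mG i A : <<s F i >> A -> measurable A.
  by move=> sA; apply: sA; split; [exact: sigma_algebra_measurable|exact: Fm].
(* The generators are replaced by sigma-algebras one index at a time. *)
suff claim J1 : forall J2 E, uniq (J1 ++ J2) ->
    (forall i, i \in J1 -> <<s F i >> (E i)) -> (forall i, i \in J2 -> F i (E i)) ->
    P (\bigcap_(i in [set` J1 ++ J2]) E i) = (\prod_(i <- J1 ++ J2) P (E i))%E.
  by move=> J E uJ EJ; have := claim J [::] E; rewrite cats0; apply.
elim: J1 => [|i J1 IH] J2 E uJ E1 E2; first exact: ind.
move: uJ; rewrite cat_cons cons_uniq => /andP[iJ uJ].
have E1' j : j \in J1 -> <<s F j >> (E j).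
  by move=> jJ; apply: E1; rewrite inE jJ orbT.
pose H := \bigcap_(j in [set` J1 ++ J2]) E j.
have PH : P H = (\prod_(j <- J1 ++ J2) P (E j))%E by exact: IH.
rewrite bigcap_eqseq !big_cons -bigcap_eqseq -/H -PH.
apply: (@product_rule_sigma (F i)) => //; last by apply: E1; rewrite mem_head.
  rewrite /H bigcap_eqseq big_seq; apply: big_ind => //; first exact: measurableI.
  move=> j; rewrite mem_cat => /orP[/E1'/mG//|/E2/Fm//].
(* For [B] in the generator [F i], the index [i] may be counted in the second list, where the
   induction hypothesis applies to [E']. *)
move=> B FB; pose E' j := if j == i then B else E j.
have E'E j : j \in J1 ++ J2 -> E' j = E j.
  by rewrite /E'; case: eqP => // -> ; rewrite (negPf iJ).
have perm : perm_eq (J1 ++ i :: J2) (i :: (J1 ++ J2)).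
  by rewrite -cat1s perm_catCA.
have := IH (i :: J2) E'; rewrite bigcap_eqseq !(perm_big _ perm) !big_cons.
have -> : E' i = B by rewrite /E' eqxx.
have -> : \big[setI/setT]_(j <- J1 ++ J2) E' j = H.
  by rewrite /H bigcap_eqseq; apply: eq_big_seq => j /E'E.
have -> : (\prod_(j <- J1 ++ J2) P (E' j) = P H)%E.
  by rewrite PH; apply: eq_big_seq => j /E'E ->.
apply.
- by rewrite (perm_uniq perm) cons_uniq iJ.
- by move=> j jJ1; rewrite E'E; [exact: E1'|rewrite mem_cat jJ1].
- move=> j; rewrite inE /E'; case: eqP => [->//|_ /=]; exact: E2.
Qed.

(** Finite intersections of events from the sources of one group form a pi-system generating the
    sigma-algebra of that group. The product rule for these boxes follows from independence of the
    sources, since boxes of different groups involve disjoint indices. *)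
Lemma mutually_independent_group (I K : eqType) (grp : I -> K)
    (F : I -> set (set Omega)) :
  (forall i, F i `<=` measurable) -> (forall i, sigma_algebra setT (F i)) ->
  mutually_independent P F ->
  mutually_independent P
    (fun k => <<s \bigcup_(i in [set i | grp i = k]) F i >>).
Proof.
move=> Fm Fs ind.
have FT i : F i setT by case: (Fs i) => F0 FC _; rewrite -setC0 -setTD; exact: FC.
have FI i : setI_closed (F i) by exact: sigma_algebra_setI.
pose box k := [set A | exists S E, [/\ uniq S, forall i : I, i \in S -> grp i = k,
  forall i, F i (E i) & A = \bigcap_(i in [set` S]) E i]].
have boxm k : box k `<=` measurable.
  move=> _ [S [E [_ _ FE ->]]]; rewrite bigcap_eqseq.
  apply: big_ind => //; first exact: measurableI.
  by move=> i _; exact: Fm.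
apply: (@mutually_independentS _ (fun k => <<s box k >>)).
  move=> k; apply: sub_sigma_algebra2 => A [i /= ik FA].
  exists [:: i], (fun j => if j == i then A else setT); split => //.
  - by move=> j; rewrite inE => /eqP ->.
  - by move=> j; case: eqP => [->|].
  - by rewrite bigcap_eqseq big_seq1 eqxx.
apply: mutually_independent_sigma => //.
(* Two boxes meet in a box over the union of their index lists; an index missing from one list
   contributes [setT] on that side. *)
- move=> k _ _ [S [E [uS Sk FE ->]]] [S' [E' [uS' S'k FE' ->]]].
  exists (undup (S ++ S')), (fun i => (if i \in S then E i else setT) `&`
     (if i \in S' then E' i else setT)); split.
  + exact: undup_uniq.
  + by move=> i; rewrite mem_undup mem_cat => /orP[/Sk|/S'k].
  + by move=> i; apply: FI; case: ifP.
  + apply/seteqP; split => w.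
      by move=> [h h'] i /= _; split; case: ifPn => // ?; [exact: h|exact: h'].
    move=> h; split => i /= iS.
      have [] := h i; first by rewrite /= mem_undup mem_cat iS.
      by rewrite iS.
    have [] := h i; first by rewrite /= mem_undup mem_cat iS orbT.
    by rewrite iS.
- move=> J A uJ AJ.
  have /choice[SE SEP] k : exists SE : seq I * (I -> set Omega), k \in J ->
      [/\ uniq SE.1, forall i : I, i \in SE.1 -> grp i = k,
      forall i, F i (SE.2 i) & A k = \bigcap_(i in [set` SE.1]) SE.2 i].
    case: (boolP (k \in J)) => [/AJ[S [E h]]|_]; last by exists ([::], fun=> setT).
    by exists (S, E).
  (* An index determines its group, so dropping the first components of [D] creates no repetition in
     [L]. *)
  pose D := [seq (k, i) | k <- J, i <- (SE k).1].
  pose L := [seq u.2 | u <- D].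
  pose E i := (SE (grp i)).2 i.
  have grpD u : u \in D -> grp u.2 = u.1.
    by move=> /allpairsPdep[k [i [kJ iS ->]]]; have [_ + _ _] := SEP k kJ; exact.
  have uL : uniq L.
    rewrite map_inj_in_uniq.
      apply: allpairs_uniq_dep => //; first by move=> k /SEP[].
      by move=> [? ?] [? ?] _ _ [-> ->].
    move=> [k i] [k' i'] /grpD/= <- /grpD/= <- <-//.
  have PE k : k \in J -> P (A k) = (\prod_(i <- (SE k).1) P ((SE k).2 i))%E.
    by move=> kJ; have [uS Sk FE ->] := SEP k kJ; apply: ind.
  rewrite (eq_big_seq _ PE).
  have -> : \bigcap_(k in [set` J]) A k = \bigcap_(i in [set` L]) E i.
    apply/seteqP; split => w h.
      move=> i /= /mapP[[k j] kjD /= ->].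
      have /= := grpD _ kjD; rewrite /E => ->.
      have /allpairsPdep[k' [j' [k'J j'S [? ?]]]] := kjD; subst k' j'.
      by have := h k k'J; have [_ _ _ ->] := SEP k k'J; apply.
    move=> k /= kJ; have [_ Sk _ ->] := SEP k kJ => i /= iS.
    have := h i; rewrite /E (Sk _ iS); apply.
    apply/mapP; exists (k, i) => //; apply/allpairsPdep.
    by exists k, i.
  rewrite ind//; last first.
    move=> i /mapP[[k j] kjD /= ->]; rewrite /E.
    have /= -> := grpD _ kjD.
    have /allpairsPdep[k' [j' [k'J _ [? ?]]]] := kjD; subst k' j'.
    by have [_ _ + _] := SEP k k'J.
  rewrite /L big_map big_allpairs_dep /=.
  apply: eq_big_seq => k kJ; apply: eq_big_seq => i iS.
  by have [_ Sk _ _] := SEP k kJ; rewrite /E Sk.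
Qed.

End independence.

(** * Measurability of survival *)

Lemma countable_bigcup_measurable d (T : measurableType d) (C : countType)
    (F : C -> set T) :
  (forall c, measurable (F c)) -> measurable (\bigcup_c F c).
Proof. exact/countable_bigcupT_measurable/countableP. Qed.

Lemma discrete_measurable_preimage d (T : measurableType d) (C : countType)
    (X : T -> C) (A : set C) :
  Defs.discrete_measurable X -> measurable (X @^-1` A).
Proof.
move=> mX; have -> : X @^-1` A = \bigcup_c (if c \in A then X @^-1` [set c] else set0).
  apply/seteqP; split => w /=; first by move=> AX; exists (X w); rewrite // mem_set.
  by move=> [c _]; case: ifPn => // /set_mem Ac /= ->.
by apply: countable_bigcup_measurable => c; case: ifP.
Qed.

(** An infimum is below [r] exactly when some admissible value is, so preimages of rays are
    countable unions even though the index set depends on [w]. *)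
Lemma measurable_fun_ereal_inf (R : realType) d (T : measurableType d)
    (C : countType) (D : C -> set T) (f : C -> T -> \bar R) :
  (forall c, measurable (D c)) -> (forall c, measurable_fun setT (f c)) ->
  measurable_fun setT (fun w => ereal_inf [set f c w | c in [set c | D c w]]).
Proof.
move=> mD mf; apply: (measurability _ (ErealGenInftyO.measurableE R)) => //.
move=> _ [_ [r ->] <-]; rewrite setTI.
rewrite (_ : _ @^-1` _ = \bigcup_c (D c `&` (f c @^-1` `]-oo, r%:E[%classic))).
  apply: countable_bigcup_measurable => c; apply: measurableI => //.
  by rewrite -[X in measurable X]setTI; apply: (mf c) => //; exact: emeasurable_itv.
apply/seteqP; split => w /=; rewrite in_itv /=.
  by move=> /ereal_inf_lt[_ [c Dcw <-] h]; exists c => //; split => //=; rewrite in_itv.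
move=> [c _ [Dcw]] /=; rewrite in_itv /=; apply: le_lt_trans.
by apply: ereal_inf_lbound; exists c.
Qed.

Section survival_measurable.
Context {R : realType} {G : graph} {p : {i01 R}} {d0 : measure_display}.
Context {T0 : measurableType d0} {Q : probability T0 R} {eta : {RV Q >-> nat}}.
Variable F : frog_model G p eta.

Lemma count_measurable x (A : set nat) : measurable (fm_count F x @^-1` A).
Proof. by rewrite -[X in measurable X]setTI; exact: measurable_funP. Qed.

Lemma life_measurable x i (A : set (option nat)) : measurable (fm_life F x i @^-1` A).
Proof. by apply: discrete_measurable_preimage; have [] := fm_lifeP F x i. Qed.

Lemma walk_measurable x i n (A : set G) : measurable (fm_walk F x i n @^-1` A).
Proof. by apply: discrete_measurable_preimage; have [] := fm_walkP F x i. Qed.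

Lemma hitting_time_measurable x y :
  measurable_fun setT (fun w : fm_space F => hitting_time w x y).
Proof.
apply: (@measurable_fun_ereal_inf _ _ _ nat
  (fun n => [set w | exists i, [/\ (i < fm_count F x w)%N,
    alive n (fm_life F x i w) & fm_walk F x i n w = y]]) (fun n _ => n%:R%:E)) => // n.
rewrite (_ : mkset _ = \bigcup_i (fm_count F x @^-1` [set k | (i < k)%N] `&`
   fm_life F x i @^-1` [set o | alive n o] `&` fm_walk F x i n @^-1` [set y])).
  apply: bigcupT_measurable => i; apply: measurableI; last exact: walk_measurable.
  by apply: measurableI; [exact: count_measurable|exact: life_measurable].
apply/seteqP; split => w /=.
  by move=> [i [? ? ?]]; exists i.
by move=> [i _ [[? ?] ?]]; exists i.
Qed.

Lemma activation_time_measurable x :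
  measurable_fun setT (fun w : fm_space F => activation_time w x).
Proof.
apply: (@measurable_fun_ereal_inf _ _ _ (seq G)
  (fun s => [set w : fm_space F | last (graph_root G) s = x])
  (fun s (w : fm_space F) =>
     (\sum_(u <- pairmap (hitting_time w) (graph_root G) s) u)%E)).
  move=> s; have [h|h] := pselect (last (graph_root G) s = x).
    by rewrite (_ : mkset _ = setT)//; apply/seteqP; split.
  by rewrite (_ : mkset _ = set0)//; apply/seteqP; split.
move=> s; elim: s (graph_root G) => [|y s IH] z /=.
  by under eq_fun do rewrite big_nil; exact: measurable_cst.
under eq_fun do rewrite big_cons.
by apply: emeasurable_funD; [exact: hitting_time_measurable|exact: IH].
Qed.

Lemma active_at_measurable n x i : measurable [set w : fm_space F | active_at w n x i].
Proof.
rewrite (_ : mkset _ = fm_count F x @^-1` [set k | (i < k)%N] `&`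
  \bigcup_(m in [set m | (m <= n)%N])
    ((fun w : fm_space F => activation_time w x) @^-1` [set m%:R%:E] `&`
     fm_life F x i @^-1` [set o | alive (n - m) o])).
  apply: measurableI; first exact: count_measurable.
  apply: bigcup_measurable => m _; apply: measurableI; last exact: life_measurable.
  by rewrite -[X in measurable X]setTI; apply: (activation_time_measurable x).
apply/seteqP; split => w /=.
  by move=> [? [m [? ? ?]]]; split => //; exists m.
by move=> [? [m ? [? ?]]]; split => //; exists m.
Qed.

Lemma survives_measurable : measurable (survives (F := F)).
Proof.
rewrite (_ : survives (F := F) =
  \bigcap_n \bigcup_x \bigcup_i [set w : fm_space F | active_at w n x i]).
  apply: bigcapT_measurable => n; apply: countable_bigcup_measurable => x.
  by apply: bigcupT_measurable => i; exact: active_at_measurable.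
apply/seteqP; split => w /=.
  by move=> h n _; have [x [i a]] := h n; exists x => //; exists i.
by move=> h n; have [x _ [i _ a]] := h n I; exists x, i.
Qed.

Lemma activation_time_root (w : fm_space F) : activation_time w (graph_root G) = 0%E.
Proof.
apply/eqP; rewrite eq_le; apply/andP; split.
  by apply: ereal_inf_lbound; exists [::] => //=; rewrite big_nil.
apply: le_ereal_inf_tmp => _ [s _ <-]; elim: s (graph_root G) => [|y s IH] z /=.
  by rewrite big_nil.
rewrite big_cons adde_ge0//; apply: le_ereal_inf_tmp => _ [n _ <-].
by rewrite lee_fin.
Qed.

End survival_measurable.

(** * Confinement by barriers *)

(* The sites of level [m] are [m] and [-m-1], so that each level has exactly
   two sites and one step of the walk raises the level by at most one. *)
Definition level (z : int) : nat := match z with Posz n => n | Negz n => n end.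

Lemma level_nbrs (z z' : int) : z' \in Z_nbrs z -> (level z' <= (level z).+1)%N.
Proof.
by rewrite !inE => /orP[] /eqP; case: z z' => [n|n] [m|m] /=; rewrite ?NegzE; lia.
Qed.

Lemma aliveW (m n : nat) o : (m <= n)%N -> alive n o -> alive m o.
Proof. by case: o => [k|//] /=; exact: leq_ltn_trans. Qed.

Section confinement.
Context {R : realType} {p : {i01 R}} {d0 : measure_display}.
Context {T0 : measurableType d0} {Q : probability T0 R} {eta : {RV Q >-> nat}}.
Variable F : frog_model Z_graph p eta.
Implicit Types (w : fm_space F) (x y : int).

(** Imposed on all particles of the site, activated or not, so that the event involves only counts
    and lifetimes of that site. *)
Definition quiet x (k : nat) : set (fm_space F) :=
  [set w | forall i, (i < fm_count F x w)%N -> ~~ alive k (fm_life F x i w)].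

(** From [x], at least [n - level x] steps are needed to reach level [n]; a barrier makes every
    particle starting below level [n] die before that. *)
Definition barrier (n : nat) : set (fm_space F) :=
  \bigcap_(x in [set x | (level x < n)%N]) quiet x (n - level x).

(** The almost sure properties on which the pathwise argument rests; finite lifetimes make this an
    event of full probability only when [p < 1]. *)
Definition regular : set (fm_space F) :=
  [set w | forall x i, [/\ fm_life F x i w <> None, fm_walk F x i 0 w = x &
    forall n, fm_walk F x i n.+1 w \in Z_nbrs (fm_walk F x i n w)]].

Lemma level_walk w x i n : regular w ->
  (level (fm_walk F x i n w) <= level x + n)%N.
Proof.
move=> /(_ x i)[_ S0 Snbr]; elim: n => [|n IH]; first by rewrite S0 addn0.
by rewrite addnS (leq_trans (level_nbrs _ _ (Snbr n))).
Qed.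

Lemma hitting_time_lty w x y : (hitting_time w x y < +oo)%E ->
  exists n i, [/\ (i < fm_count F x w)%N, alive n (fm_life F x i w) &
    fm_walk F x i n w = y].
Proof. by move=> /ereal_inf_lt[_ [n [i h] _] _]; exists n, i. Qed.

Lemma hitting_time_ge0 w x y : (0 <= hitting_time w x y)%E.
Proof. by apply/ereal_infP => _ [n _ <-]; rewrite lee_fin. Qed.

(** Induction along a sequence of finite total time: each of its hitting times is realised by a
    particle still alive on arrival, and the barrier stops such a particle from leaving the levels
    up to [n]. *)
Lemma barrier_confines w n x : regular w -> barrier n.+1 w ->
  (activation_time w x < +oo)%E -> (level x <= n)%N.
Proof.
move=> reg bar /ereal_inf_lt[_ [s <- <-]].
(* The start is generalised to any site of level at most [n], which is what the induction
   preserves. *)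
have : (level (graph_root Z_graph) <= n)%N by [].
move: (graph_root Z_graph) => z.
elim: s z => [//|y s IH] z /= zn.
rewrite big_cons => fin.
have s0 : (0 <= \sum_(u <- pairmap (hitting_time w) y s) u)%E.
  elim: s y {IH fin} => [|u s IH] y /=; rewrite ?big_nil// big_cons.
  by rewrite adde_ge0 ?hitting_time_ge0.
apply: IH; last by apply: le_lt_trans fin; rewrite leeDr ?hitting_time_ge0.
have /hitting_time_lty[k [i [ic al <-]]] : (hitting_time w z y < +oo)%E.
  by apply: le_lt_trans fin; rewrite leeDl.
have kn : (k < n.+1 - level z)%N.
  rewrite ltnNge; apply/negP => le; move: (bar z zn i ic).
  by rewrite (aliveW _ _ _ le al).
rewrite (leq_trans (level_walk _ _ _ _ reg))// -ltnS.
by rewrite -(subnK (leqW zn)) addnC ltn_add2r.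
Qed.

(** Only finitely many sites are ever activated, each with finitely many particles of finite
    lifetime, so one time bounds all their activity. *)
Lemma barrier_extinction w n : regular w -> barrier n.+1 w -> ~ survives w.
Proof.
move=> reg bar surv.
(* The bound is activation time plus lifetime, or 0 if the site has no finite activation time and
   its particles are never active. *)
have bound x i : exists b, forall k, active_at w k x i -> (k < b)%N.
  have [[m mE]|no] := pselect (exists m, activation_time w x = (m%:R : R)%:E).
    have [lNone _ _] := reg x i.
    case El : (fm_life F x i w) lNone => [l|] // _.
    exists (m + l)%N => k [_ [m' [m'E m'k]]]; rewrite El /= => kl.
    have mm' : m = m' by move: m'E; rewrite mE => -[] /eqP; rewrite eqr_nat => /eqP.
    by rewrite mm' -ltn_subLR.
  by exists 0%N => k [_ [m [mE _ _]]]; case: no; exists m.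
have {bound} /choice[b bP] : forall u : int * nat, exists b, forall k,
    active_at w k u.1 u.2 -> (k < b)%N by move=> [x i]; exact: bound.
pose sites := [seq Posz m | m <- iota 0 n.+1] ++ [seq Negz m | m <- iota 0 n.+1].
pose parts := [seq (x, i) | x <- sites, i <- iota 0 (fm_count F x w)].
have [x [i act]] := surv (\max_(u <- parts) b u).
have [ic [m [mE _ _]]] := act.
have := bP (x, i) _ act; rewrite ltnNge => /negP; apply.
apply: leq_bigmax_seq => //; apply/allpairsPdep; exists x, i; split => //; last first.
  by rewrite mem_iota.
have : (level x <= n)%N by apply: barrier_confines reg bar _; rewrite mE ltry.
rewrite mem_cat; case: (x) => j jn; apply/orP; [left|right];
  by apply: map_f; rewrite mem_iota ltnS.
Qed.

End confinement.

(** * Summability estimates *)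

(** Passes from levels to distances: as [m] increases from [a] to [a + n - 1], the distance to level
    [a + n] decreases from [n] to 1. *)
Lemma big_iota_rev (R : Type) (idx : R) (op : Monoid.com_law idx) (a n : nat)
    (h : nat -> R) :
  \big[op/idx]_(m <- iota a n) h (a + n - m.+1)%N = \big[op/idx]_(k < n) h k.
Proof.
rewrite -[a in iota a]addn0 iotaDl big_map -[n in iota 0 n]subn0.
rewrite -/(index_iota 0 n) big_nat_rev /= big_mkord; apply: eq_bigr => k _.
by congr h; have := ltn_ord k; lia.
Qed.

(** Take [K] such that the partial sum of length [K] is within [eps] of the supremum of all partial
    sums. *)
Lemma uniform_small_tail (R : realType) (q : nat -> R) (B : R) :
  (forall k, 0 <= q k) -> (forall n, \sum_(k < n) q k <= B) ->
  forall eps, 0 < eps -> exists K, forall n, \sum_(k < n) q (K + k)%N <= eps.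
Proof.
move=> q0 qB eps eps0; pose S := [set \sum_(k < n) q k | n in [set: nat]].
have hS : has_sup S.
  by split; [exists (\sum_(k < 0) q k), 0%N|exists B => _ [n _ <-]].
have [_ [K _ <-] supK] := sup_adherent eps0 hS; exists K => n.
have : \sum_(k < K + n) q k <= sup S by apply: ub_le_sup; [case: hS|exists (K + n)%N].
rewrite big_split_ord /= => le; rewrite -(lerD2l (\sum_(k < K) q k)).
by rewrite (le_trans le)// -lerBlDr ltW.
Qed.

(** The constant must serve all [f] and [n] at once. The first [K] factors are bounded below by
    [delta], and the others have product at least 1/2 once the tail of [q] beyond [K] is at most
    1/2. *)
Lemma prod_lower_bound (R : realType) (q : nat -> R) (B delta : R) :
  (forall k, 0 <= q k) -> (forall n, \sum_(k < n) q k <= B) ->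
  0 < delta -> exists2 c, 0 < c <= 1 &
  forall f : nat -> R, (forall k, delta <= f k <= 1) -> (forall k, 1 - q k <= f k) ->
    forall n, c <= \prod_(k < n) f k.
Proof.
move=> q0 qB delta0; have half0 : 0 < 2^-1 :> R by rewrite invr_gt0.
have [K tailK] := uniform_small_tail _ _ _ q0 qB _ half0.
(* Capping at 1 ensures [c <= 1]. *)
pose del := Num.min delta 1.
have del0 : 0 < del by rewrite lt_min delta0 ltr01.
have del1 : del <= 1 by rewrite ge_min lexx orbT.
exists (del ^+ K / 2).
  apply/andP; split; first by rewrite divr_gt0// exprn_gt0.
  have : del ^+ K <= 1 by rewrite exprn_ile1// ltW.
  by move=> h; lra.
move=> f fdel fq n.
have f0 k : 0 <= f k by have /andP[h _] := fdel k; rewrite (le_trans _ h)// ltW.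
have f1 k : f k <= 1 by have /andP[] := fdel k.
(* Extending the product to [K + n] factors only decreases it. *)
have ge : \prod_(k < K + n) f k <= \prod_(k < n) f k.
  rewrite addnC big_split_ord /= ler_piMr ?prodr_ge0//.
  by rewrite prodr_ile1// => i _; rewrite f0 f1.
apply: le_trans ge; rewrite big_split_ord /=.
(* Weierstrass's product inequality. *)
have weier m : 1 - \sum_(k < m) q (K + k)%N <= \prod_(k < m) f (K + k)%N.
  elim: m => [|m IH]; first by rewrite !big_ord0 subr0.
  rewrite !big_ord_recr /=.
  have p0 : 0 <= \prod_(k < m) f (K + k)%N by rewrite prodr_ge0.
  have p1 : \prod_(k < m) f (K + k)%N <= 1.
    by rewrite prodr_ile1// => i _; rewrite f0 f1.
  have le1 := ler_wpM2l p0 (fq (K + m)%N).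
  have le2 := ler_wpM2l (q0 (K + m)%N) p1.
  apply: le_trans le1; rewrite mulr1 in le2.
  by rewrite mulrBr mulr1 opprD addrA lerB// mulrC.
have half : 2^-1 <= \prod_(k < n) f (K + k)%N.
  by apply: le_trans (weier n); have := tailK n; lra.
have -> : del ^+ K = \prod_(k < K) del by rewrite prodr_const card_ord.
apply: ler_pM half; rewrite ?invr_ge0 ?prodr_ge0 ?(ltW del0)//.
apply: ler_prod => k _.
have /andP[fk _] := fdel k.
by rewrite ltW//= ge_min fk.
Qed.

(** At most [y / a] positive multiples of [a] lie below [y]. If the last one does, the trivial bound
    by the number of terms suffices; otherwise its term is zero and is dropped. *)
Lemma sum_indic_le (R : realType) (a y : R) n : 0 < a -> 0 <= y ->
  \sum_(k < n) (if k.+1%:R * a <= y then 1 else 0) <= a^-1 * y.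
Proof.
move=> a0 y0.
have bn : \sum_(k < n) (if k.+1%:R * a <= y then 1 else 0) <= n%:R :> R.
  rewrite -[n in leRHS]card_ord -sumr_const; apply: ler_sum => k _.
  by case: ifP.
elim: n bn => [|n IH] bn; first by rewrite big_ord0 mulr_ge0// invr_ge0 ltW.
case: (boolP (n.+1%:R * a <= y)) => h.
  by rewrite (le_trans bn)// ler_pdivlMl// mulrC.
rewrite big_ord_recr /= (negPf h) addr0; apply: IH.
rewrite -[n in leRHS]card_ord -sumr_const; apply: ler_sum => k _.
by case: ifP.
Qed.

(** The pointwise count of [sum_indic_le], integrated. *)
Lemma sum_tail_le_expectation (R : realType) d (T : measurableType d)
    (Q : probability T R) (Y : T -> R) (a : R) n :
  measurable_fun setT Y -> (forall w, 0 <= Y w) -> 0 < a ->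
  (\sum_(k < n) Q [set w | (k.+1%:R * a <= Y w)%R] <= a^-1%:E * 'E_Q[Y])%E.
Proof.
move=> mY Y0 a0.
have mA k : measurable [set w | k.+1%:R * a <= Y w].
  rewrite (_ : mkset _ = Y @^-1` `[k.+1%:R * a, +oo[%classic).
    by rewrite -[X in measurable X]setTI; apply: mY.
  by apply/seteqP; split => w; rewrite /= in_itv /= andbT.
have mEY : measurable_fun setT (EFin \o Y) by exact/measurable_EFinP.
have -> : 'E_Q[Y]%E = (\int[Q]_w (EFin \o Y) w)%E by rewrite unlock.
rewrite -ge0_integralZl//; last 2 first.
- by move=> w _; rewrite /= lee_fin.
- by rewrite lee_fin invr_ge0 ltW.
under eq_bigr => k _ do rewrite -[X in Q X]setIT -(integral_indic Q measurableT (mA k)).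
rewrite -ge0_integral_sum//; last first.
  by move=> k; apply/measurable_EFinP; exact: measurable_indic.
apply: ge0_le_integral => //.
- by move=> w _; apply: sume_ge0 => k _; rewrite lee_fin.
- by apply: emeasurable_sum => k; apply/measurable_EFinP; exact: measurable_indic.
- by apply: measurable_funeM.
- move=> w _; rewrite sumEFin lee_fin.
  apply: le_trans (sum_indic_le _ _ _ n a0 (Y0 w)).
  apply: ler_sum => k _; rewrite indicE; case: ifPn => h; first by case: (_ \in _).
  by rewrite memNset//; exact/negP.
Qed.

Lemma sum_geometric_le (R : realFieldType) (s : R) n : 0 <= s < 1 ->
  \sum_(k < n) s ^+ k <= (1 - s)^-1.
Proof.
move=> /andP[s0 s1]; rewrite -[leRHS]mul1r ler_pdivlMr ?subr_gt0// mulrC.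
suff -> : (1 - s) * \sum_(k < n) s ^+ k = 1 - s ^+ n by rewrite gerBl exprn_ge0.
elim: n => [|n IH]; first by rewrite big_ord0 mulr0 expr0 subrr.
by rewrite big_ord_recr /= mulrDr IH exprS; ring.
Qed.

(* With [s = (1 + p) / 2] one has [p <= s ^+ 2], so that [M k ~ s ^- k.+1]
   balances the two terms: the first is [Q (ln eta >= k.+1 * - ln s)] and the
   second is at most [2 * s ^+ k.+1]. *)
Lemma logarithmic_moment_summable (R : realType) (d : measure_display)
    (T : measurableType d) (Q : probability T R) (eta : {RV Q >-> nat}) (p : R) :
  0 <= p < 1 -> ('E_Q [fun w => ln (maxn (eta w) 1)%:R] < +oo)%E ->
  exists (M : nat -> nat) (q : nat -> R) (B : R),
  [/\ forall k, 0 <= q k, forall n, \sum_(k < n) q k <= B &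
      forall k, (Q [set w | (M k <= eta w)%N] + ((M k)%:R * p ^+ k.+1)%:E <= (q k)%:E)%E].
Proof.
move=> /andP[p0 p1] Efin; pose s := (1 + p) / 2.
have s0 : 0 < s by rewrite /s; lra.
have s1 : s < 1 by rewrite /s; lra.
(* Indeed [s ^+ 2 - p = (1 - p) ^+ 2 / 4]. *)
have ps : p <= s ^+ 2 by rewrite /s expr2; have := sqr_ge0 (1 - p); rewrite expr2; lra.
pose a := - ln s; have a0 : 0 < a by rewrite oppr_gt0 ln_lt0// s0.
pose Y w : R := ln (maxn (eta w) 1)%:R.
have Y0 w : 0 <= Y w by rewrite ln_ge0// ler1n leq_maxr.
have mY : measurable_fun setT Y.
  apply: (@measurableT_comp _ _ _ _ _ _ (fun n : nat => ln (maxn n 1)%:R : R)) => //.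
pose A k := [set w | k.+1%:R * a <= Y w].
have mA k : measurable (A k).
  rewrite (_ : A k = Y @^-1` `[k.+1%:R * a, +oo[%classic).
    by rewrite -[X in measurable X]setTI; apply: mY.
  by apply/seteqP; split => w; rewrite /A /= in_itv /= andbT.
have E0 : (0 <= 'E_Q[Y])%E.
  by apply: expectation_ge0.
have EE : 'E_Q[Y]%E = (fine 'E_Q[Y])%:E by rewrite fineK// ge0_fin_numE.
have QA k : Q (A k) = (fine (Q (A k)))%:E by rewrite fineK// fin_num_measure.
(* The successor makes [M k] exceed [s ^- k.+1], so that [M k <= eta w] forces
   [k.+1%:R * a <= Y w]. *)
pose M k := (Num.truncn (s ^- k.+1)).+1.
exists M, (fun k => fine (Q (A k)) + 2 * s ^+ k.+1),
  (a^-1 * fine 'E_Q[Y] + 2 * (1 - s)^-1); split.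
- by move=> k; rewrite addr_ge0 ?fine_ge0// mulr_ge0// exprn_ge0// ltW.
- move=> n; rewrite big_split /= lerD//.
    have := sum_tail_le_expectation _ _ _ Q Y a n mY Y0 a0.
    rewrite EE -EFinM (_ : bigop _ _ _ = (\sum_(k < n) fine (Q (A k)))%:E) ?lee_fin//.
    by rewrite -sumEFin; apply: eq_bigr => k _; rewrite -QA.
  rewrite -mulr_sumr ler_wpM2l//.
  apply: le_trans (sum_geometric_le _ s n _); last by rewrite s1 ltW.
  by apply: ler_sum => k _; rewrite exprS ler_piMl ?exprn_ge0 ?ltW.
- move=> k; rewrite EFinD; apply: leeD.
    rewrite -QA; apply: le_measure; rewrite ?inE//.
      rewrite (_ : mkset _ = eta @^-1` [set n | (M k <= n)%N])//.
      by rewrite -[X in measurable X]setTI; exact: measurable_funP.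
    move=> w /= Mk; rewrite /A /Y /=.
    have le : s ^- k.+1 <= (maxn (eta w) 1)%:R.
      apply: le_trans (ltW (truncnS_gt (s ^- k.+1))) _.
      by rewrite ler_nat (leq_trans Mk)// leq_maxl.
    rewrite (_ : _ * a = ln (s ^- k.+1)); last first.
      by rewrite lnV ?posrE ?exprn_gt0// lnXn// /a mulrN mulr_natl.
    by rewrite ler_ln// posrE ?invr_gt0 ?exprn_gt0// ltr0n leq_max orbT.
  rewrite lee_fin.
  have sk0 : 0 < s ^+ k.+1 by rewrite exprn_gt0.
  have sk1 : s ^+ k.+1 <= 1 by rewrite exprn_ile1// ltW.
  have Mle : (M k)%:R <= s ^- k.+1 + 1.
    by rewrite /M -natr1 lerD2r truncn_le invr_ge0 ltW.
  have pk : p ^+ k.+1 <= s ^+ k.+1 * s ^+ k.+1.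
    by rewrite -expr2 -exprM mulnC exprM lerXn2r ?nnegrE ?exprn_ge0// ltW.
  apply: le_trans (ler_pM _ _ Mle pk) _; rewrite ?exprn_ge0//.
  by rewrite mulrDl mul1r mulKf ?gt_eqF// mulr_natl mulr2n lerD2l ler_piMl// ltW.
Qed.

(** * Probability of barriers *)

Lemma sigma_of_preimage d (Omega : measurableType d) (C : countType) (X : Omega -> C)
    (A : set C) : sigma_of (fun _ : unit => X) (X @^-1` A).
Proof.
apply: (@discrete_measurable_preimage _
  (g_sigma_algebraType [set E | exists (_ : unit) a, E = X @^-1` [set a]])).
by move=> a; apply: sub_sigma_algebra; exists tt, a.
Qed.

Lemma countable_bigcup_negligible (R : realType) d (T : measurableType d)
    (mu : {measure set T -> \bar R}) (C : countType) (F : C -> set T) :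
  (forall c, mu.-negligible (F c)) -> mu.-negligible (\bigcup_c F c).
Proof.
move=> nF; apply: (@negligibleS _ _ _ _
    (\bigcup_n if unpickle n is Some c then F c else set0)).
  by move=> w [c _ Fw]; exists (pickle c); rewrite // pickleK.
apply: negligible_bigcup => n; case: unpickle => [c|]; first exact: nF.
exact: negligible_set0.
Qed.

(** There are countably many finite paths, and the law gives probability zero to each one with a
    wrong start or a forbidden last step. *)
Lemma simple_random_walk_nearest_neighbour (R : realType) (G : graph) d
    (Omega : measurableType d) (P : probability Omega R) (x : G)
    (S : nat -> Omega -> G) : simple_random_walk P x S ->
  P.-negligible [set w | ~ (S 0%N w = x /\ forall n, S n.+1 w \in nbrs (S n w))].
Proof.
move=> [mS law].
(* Paths are coded by sequences, which form a countable type, and read through [nth] with default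
   [x]. *)
pose bad n (s : seq G) := [set w | (forall k, (k <= n.+1)%N -> S k w = nth x s k) /\
  ~~ ((nth x s 0 == x) && (nth x s n.+1 \in nbrs (nth x s n)))].
apply: (@negligibleS _ _ _ _ (\bigcup_n \bigcup_s bad n s)).
  move=> w /= h; have [n hn] : exists n,
      ~~ ((S 0%N w == x) && (S n.+1 w \in nbrs (S n w))).
    apply: contrapT => nex; apply: h.
    have h n : (S 0%N w == x) && (S n.+1 w \in nbrs (S n w)).
      by apply: contrapT => /negP hn; apply: nex; exists n.
    by split=> [|n]; [have /andP[/eqP] := h 0%N|have /andP[] := h n].
  exists n => //; exists (mkseq (S ^~ w) n.+2) => //; split.
    by move=> k kn; rewrite nth_mkseq.
  by rewrite !nth_mkseq.
apply: negligible_bigcup => n; apply: countable_bigcup_negligible => s.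
have [ok|ko] := boolP ((nth x s 0 == x) && (nth x s n.+1 \in nbrs (nth x s n))).
  by apply: (@negligibleS _ _ _ _ set0); [move=> w []; rewrite ok|exact: negligible_set0].
pose path := [set w | forall k, (k <= n.+1)%N -> S k w = nth x s k].
apply: (@negligibleS _ _ _ _ path); first by move=> w [].
apply/negligibleP.
  rewrite (_ : path = \bigcap_(k in [set k | (k <= n.+1)%N]) (S k @^-1` [set nth x s k])).
    by apply: bigcap_measurableType => k _; exact: mS.
  by apply/seteqP; split => w h k; exact: h.
apply: (etrans (law n.+1 (nth x s))); case: ifP ko => //= _.
rewrite big_ord_recr /= => /negPf ->.
by rewrite mulr0.
Qed.

Section probabilities.
Context {R : realType} {p : {i01 R}} {d0 : measure_display}.
Context {T0 : measurableType d0} {Q : probability T0 R} {eta : {RV Q >-> nat}}.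
Variable F : frog_model Z_graph p eta.
Implicit Types x y : int.
Local Notation P := (fm_prob F).

Lemma probability_setU_le A B : measurable A -> measurable B ->
  (P (A `|` B) <= P A + P B)%E.
Proof. exact: measureU2. Qed.

Lemma regular_almost_surely : p%:num < 1 -> P.-negligible (~` regular F).
Proof.
move=> p1; apply: (@negligibleS _ _ _ _ (\bigcup_x \bigcup_i
   (fm_life F x i @^-1` [set None] `|` [set w | ~ (fm_walk F x i 0%N w = x /\
      forall n, fm_walk F x i n.+1 w \in Z_nbrs (fm_walk F x i n w))]))).
  move=> w /= nreg; apply: contrapT => h; apply: nreg => x i.
  split; first by move=> lN; apply: h; exists x => //; exists i => //; left.
    by apply: contrapT => h'; apply: h; exists x => //; exists i => //; right=> -[].
  by apply: contrapT => h'; apply: h; exists x => //; exists i => //; right=> -[].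
apply: countable_bigcup_negligible => x; apply: negligible_bigcup => i.
apply: negligibleU; last exact: simple_random_walk_nearest_neighbour (fm_walkP F x i).
apply/negligibleP; first exact: life_measurable.
by have [_ _ lifeN] := fm_lifeP F x i; apply: (etrans lifeN); rewrite lt_eqF.
Qed.

(** * Probability that a site is quiet *)

(** A particle alive at age [k] has none of the lifetimes 1 to [k], whose probabilities sum to
    [1 - p ^+ k]. *)
Lemma life_tail_le x i k :
  (P (fm_life F x i @^-1` [set o | alive k o]) <= (p%:num ^+ k)%:E)%E.
Proof.
have [_ lifeS _] := fm_lifeP F x i.
pose ev j := fm_life F x i @^-1` [set Some j.+1].
pose dead := \big[setU/set0]_(j < k) ev j.
have mdead : measurable dead by apply: bigsetU_measurable => j _; exact: life_measurable.
have Pdead : P dead = (1 - p%:num ^+ k)%:E.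
  rewrite /dead (@measure_bigsetU _ _ _ P ev).
  - rewrite (eq_bigr (fun j : 'I_k => ((1 - p%:num) * p%:num ^+ j)%:E)); last first.
      by move=> j _; exact: lifeS.
    rewrite sumEFin -mulr_sumr; congr EFin.
    by rewrite -opprB mulNr -subrX1 opprB.
  - by move=> j; exact: life_measurable.
  - apply/trivIsetP => j j' _ _ jj'; apply/seteqP; split => // w [].
    by rewrite /ev /= => -> [] /eqP; rewrite (negPf jj').
apply: (@le_trans _ _ (P (~` dead))).
  apply: le_measure; rewrite ?inE; [exact: life_measurable|exact: measurableC|].
  move=> w /= al; rewrite /dead -(bigcup_mkord k ev) => -[j /= jk lj].
  by move: lj al; rewrite /ev /= => -> /=; rewrite ltnNge jk.
by rewrite probability_setC// Pdead -EFinB lee_fin opprB addrC subrK.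
Qed.

Lemma quietE x k : quiet F x k =
  \bigcap_i (fm_count F x @^-1` [set n | (n <= i)%N] `|`
             fm_life F x i @^-1` [set o | ~~ alive k o]).
Proof.
apply/seteqP; split => w h i /=; last first.
  by move=> ic; case: (h i I) => //=; rewrite leqNgt ic.
by move=> _; have [ic|] := ltnP i (fm_count F x w); [right; exact: h|left].
Qed.

Lemma quiet_measurable x k : measurable (quiet F x k).
Proof.
rewrite quietE; apply: bigcapT_measurable => i; apply: measurableU.
  exact: count_measurable.
exact: life_measurable.
Qed.

Lemma count_law x (A : set nat) : P (fm_count F x @^-1` A) = Q (eta @^-1` A).
Proof. by have := @fm_countP _ _ _ _ _ _ _ F x A; apply. Qed.

(** If the site is not quiet, it has at least [M] particles or one of its first [M] lifetimes
    exceeds [k]. *)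
Lemma quiet_fail_le x k M : (P (~` quiet F x k) <=
   Q [set w | (M <= eta w)%N] + (M%:R * p%:num ^+ k)%:E)%E.
Proof.
pose A := fm_count F x @^-1` [set n | (M <= n)%N].
pose ev i := fm_life F x i @^-1` [set o | alive k o].
pose B := \big[setU/set0]_(i < M) ev i.
have mA : measurable A by exact: count_measurable.
have mB : measurable B by apply: bigsetU_measurable => i _; exact: life_measurable.
apply: (@le_trans _ _ (P (A `|` B))).
  apply: le_measure; rewrite ?inE; [|exact: measurableU|].
    by apply: measurableC; exact: quiet_measurable.
  move=> w nq; have [Mc|cM] := leqP M (fm_count F x w); [by left|right].
  apply: contrapT => nB; apply: nq => i ic; apply/negP => al; apply: nB.
  by rewrite /B -(bigcup_mkord M ev); exists i => //=; exact: ltn_trans cM.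
have <- : P A = Q [set w | (M <= eta w)%N] by exact: count_law.
apply: le_trans (probability_setU_le _ _ mA mB) _; apply: leeD => //.
apply: le_trans (Boole_inequality _ _) _; first by move=> i _; exact: life_measurable.
apply: (@le_trans _ _ (\sum_(i < M) (p%:num ^+ k)%:E)%E).
  by apply: lee_sum => i _; exact: life_tail_le.
by rewrite sumEFin sumr_const card_ord mulr_natl.
Qed.

(** * Independence of sites *)

Definition source (s : Z_graph + (Z_graph * nat) + (Z_graph * nat)) :
    set (set (fm_space F)) :=
  match s with
  | inl (inl x) => sigma_of (fun _ : unit => fm_count F x : _ -> nat)
  | inl (inr (x, i)) => sigma_of (fm_walk F x i)
  | inr (x, i) => sigma_of (fun _ : unit => fm_life F x i)
  end.

Definition site (s : Z_graph + (Z_graph * nat) + (Z_graph * nat)) : int :=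
  match s with inl (inl x) => x | inl (inr (x, _)) => x | inr (x, _) => x end.

Lemma source_independent : mutually_independent P source.
Proof. exact: (@fm_indep _ _ _ _ _ _ _ F). Qed.

Lemma source_sigma_algebra s : sigma_algebra setT (source s).
Proof. by case: s => [[x|[x i]]|[x i]]; exact: smallest_sigma_algebra. Qed.

Lemma source_measurable s : source s `<=` measurable.
Proof.
have sub J A (X : J -> fm_space F -> A) :
    (forall j a, measurable (X j @^-1` [set a])) -> sigma_of X `<=` measurable.
  move=> mX E; apply; split; first exact: sigma_algebra_measurable.
  by move=> _ [j [a ->]].
case: s => [[x|[x i]]|[x i]]; apply: sub => j a.
- exact: count_measurable.
- exact: walk_measurable.
- exact: life_measurable.
Qed.

(** The grouping is left free: the identity yields independence between sites, and [level x %/ g]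
    yields independence between shells. *)
Lemma quiet_source (K : Type) (grp : int -> K) x k :
  <<s \bigcup_(s in [set s | grp (site s) = grp x]) source s >> (quiet F x k).
Proof.
set G := bigcup _ _; rewrite quietE.
apply: (@bigcapT_measurable _ (g_sigma_algebraType G)) => i.
apply: (@measurableU _ (g_sigma_algebraType G)); apply: sub_sigma_algebra.
  by exists (inl (inl x)) => //; exact: sigma_of_preimage.
by exists (inr (x, i)) => //; exact: sigma_of_preimage.
Qed.

Lemma quiet_independent (J : seq int) (k : int -> nat) : uniq J ->
  P (\bigcap_(x in [set` J]) quiet F x (k x)) = (\prod_(x <- J) P (quiet F x (k x)))%E.
Proof.
move=> uJ; apply: (mutually_independent_group P _ _ site _ source_measurable
  source_sigma_algebra source_independent) => // x _.
exact: (quiet_source _ id).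
Qed.

(** If [eta = m] has positive probability, the site may hold exactly [m] particles, all dead by age
    [k.+1]; by independence this has probability at least [Q(eta = m) * (1 - p) ^ m]. *)
Lemma quiet_positive : p%:num < 1 ->
  exists2 delta : R, 0 < delta & forall x k, (delta%:E <= P (quiet F x k.+1))%E.
Proof.
move=> p1; have p0 : 0 <= p%:num :> R by [].
have [m mpos] : exists m, (0 < Q (eta @^-1` [set m]))%E.
  apply: contrapT => none.
  have null m : Q (eta @^-1` [set m]) = 0%E.
    apply/eqP; rewrite eq_le measure_ge0 andbT leNgt; apply/negP => h.
    by apply: none; exists m.
  have : Q.-negligible [set: T0].
    apply: (@negligibleS _ _ _ _ (\bigcup_m eta @^-1` [set m])).
      by move=> w _; exists (eta w).
    apply: negligible_bigcup => m; apply/negligibleP; last exact: null.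
    by rewrite -[X in measurable X]setTI; exact: measurable_funP.
  move=> /(measure_negligible measurableT) /(etrans (esym (probability_setT Q))).
  by move=> /eqP; rewrite onee_eq0.
have mE : measurable (eta @^-1` [set m]).
  by rewrite -[X in measurable X]setTI; exact: measurable_funP.
have QE : Q (eta @^-1` [set m]) = (fine (Q (eta @^-1` [set m])))%:E.
  by rewrite fineK// fin_num_measure.
exists (fine (Q (eta @^-1` [set m])) * (1 - p%:num) ^+ m).
  rewrite mulr_gt0 ?exprn_gt0 ?subr_gt0// fine_gt0// mpos /=.
  by rewrite ltey_eq fin_num_measure.
move=> x k.
pose dead i := fm_life F x i @^-1` [set o | ~~ alive k.+1 o].
pose ev (s : Z_graph + (Z_graph * nat) + (Z_graph * nat)) : set (fm_space F) :=
  match s with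
  | inl _ => fm_count F x @^-1` [set m] | inr (_, i) => dead i end.
pose J : seq (Z_graph + (Z_graph * nat) + (Z_graph * nat)) :=
  inl (inl x) :: [seq inr (x, i) | i <- iota 0 m].
have mdead i : measurable (dead i) by exact: life_measurable.
(* The age is at least 1, so [p ^+ k.+1 <= p] gives a bound uniform in [k]. *)
have deadP i : ((1 - p%:num)%:E <= P (dead i))%E.
  have -> : dead i = ~` (fm_life F x i @^-1` [set o | alive k.+1 o]).
    by apply/seteqP; split => w /= /negP.
  rewrite probability_setC; last exact: life_measurable.
  rewrite EFinB leeB// (le_trans (life_tail_le x i k.+1))// lee_fin.
  by rewrite exprS ler_piMr// exprn_ile1// ltW.
have uJ : uniq J.
  rewrite /= map_inj_uniq ?iota_uniq ?andbT; last by move=> ? ? [].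
  by apply/mapP => -[].
have evJ s : s \in J -> source s (ev s).
  rewrite inE => /orP[/eqP ->|/mapP[i _ ->]]; exact: sigma_of_preimage.
have PJ := source_independent _ _ uJ evJ.
apply: (@le_trans _ _ (P (\bigcap_(s in [set` J]) ev s))); last first.
  apply: le_measure; [apply/mem_set|apply/mem_set; exact: quiet_measurable|]; last first.
    move=> w h i ic; have /= cm := h (inl (inl x)) (mem_head _ _).
    apply: (h (inr (x, i))) => /=; rewrite inE /= map_f// mem_iota -cm; exact: ic.
  rewrite bigcap_eqseq big_seq; apply: big_ind => //; first exact: measurableI.
  by move=> s /evJ /source_measurable.
rewrite PJ /J big_cons big_map /= count_law EFinM -QE lee_wpmul2l//.
have PdE i : P (dead i) = (fine (P (dead i)))%:E by rewrite fineK// fin_num_measure.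
rewrite (eq_bigr (fun i => (fine (P (dead i)))%:E)) => [|i _]; last exact: PdE.
rewrite prodEFin lee_fin.
have -> : (1 - p%:num) ^+ m = \prod_(i <- iota 0 m) (1 - p%:num) :> R.
  by rewrite big_const_seq count_predT size_iota iter_mulr_1.
apply: ler_prod => i _; rewrite subr_ge0 ltW//=.
by rewrite -lee_fin -PdE.
Qed.

(** * Shells and cores *)

Definition sites (a n : nat) : seq int :=
  [seq Posz m | m <- iota a n] ++ [seq Negz m | m <- iota a n].

Lemma sites_uniq a n : uniq (sites a n).
Proof.
rewrite cat_uniq !map_inj_uniq ?iota_uniq ?andbT/=; last 2 first.
- by move=> ? ? [].
- by move=> ? ? [].
by apply/hasPn => _ /mapP[m _ ->]; apply/mapP => -[].
Qed.

Lemma mem_sites a n x : (x \in sites a n) = (a <= level x < a + n)%N.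
Proof.
rewrite mem_cat -mem_iota; case: x => m /=.
  rewrite mem_map; last by move=> ? ? [].
  by rewrite [X in _ || X](_ : _ = false) ?orbF//; apply/mapP => -[].
rewrite [X in _ || X]mem_map; last by move=> ? ? [].
by rewrite [X in X || _](_ : _ = false)//; apply/mapP => -[].
Qed.

(* [shell g j] and [core g j] together make up [barrier (j.+1 * g)]. The shells
   live on disjoint sets of sites, and a core only fails if a particle travels
   further than [g]. *)
Definition shell g j :=
  \bigcap_(x in [set` sites (j * g) g]) quiet F x (j.+1 * g - level x).
Definition core g j :=
  \bigcap_(x in [set` sites 0 (j * g)]) quiet F x (j.+1 * g - level x).

Lemma shell_core_barrier g j : shell g j `&` core g j `<=` barrier F (j.+1 * g).
Proof.
move=> w [sh co] x /= xlt; have [lt|ge] := ltnP (level x) (j * g).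
  by apply: co; rewrite /= mem_sites.
by apply: sh; rewrite /= mem_sites ge /= addnC -mulSn.
Qed.

Lemma quiet_bigcap_measurable (J : seq int) k :
  measurable (\bigcap_(x in [set` J]) quiet F x (k x)).
Proof.
rewrite bigcap_eqseq; apply: big_ind => //; first exact: measurableI.
by move=> x _; exact: quiet_measurable.
Qed.

(** The sites of shell [j] are those with [level x %/ g = j], so grouping the sources by this
    quotient separates the shells. *)
Lemma shell_failure_independent g n :
  P (\bigcap_(j in [set` iota 0 n]) ~` shell g j) =
  (\prod_(j <- iota 0 n) P (~` shell g j))%E.
Proof.
apply: (mutually_independent_group P _ _ (fun s => level (site s) %/ g)%N _
  source_measurable source_sigma_algebra source_independent) => [|j _].
  exact: iota_uniq.
set G := bigcup _ _; apply: (@measurableC _ (g_sigma_algebraType G)).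
rewrite /shell bigcap_eqseq big_seq; apply: big_ind => //.
  exact: (@measurableI _ (g_sigma_algebraType G)).
move=> x; rewrite mem_sites => /andP[lo hi].
have xj : (level x %/ g)%N = j.
  have g0 : (0 < g)%N by lia.
  by apply/eqP; rewrite eqn_leq -ltnS ltn_divLR// leq_divRL// lo mulSn addnC hi.
by have := quiet_source _ (fun x => level x %/ g)%N x (j.+1 * g - level x); rewrite /= xj.
Qed.

Lemma setC_bigcap_le (J : seq int) (A : int -> set (fm_space F)) :
  (forall x, measurable (A x)) ->
  (P (~` \bigcap_(x in [set` J]) A x) <= \sum_(x <- J) P (~` A x))%E.
Proof.
move=> mA; rewrite bigcap_eqseq; elim: J => [|x J IH].
  by rewrite !big_nil setCT measure0.
have mJ : measurable (\big[setI/setT]_(y <- J) A y).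
  by apply: big_ind => //; exact: measurableI.
rewrite !big_cons setCI.
apply: le_trans (probability_setU_le _ _ (measurableC (mA x)) (measurableC mJ)) _.
exact: leeD.
Qed.

(** A core site of level [m] has radius [g + (j * g - m)], so the union bound sees only the tail of
    [q] from [g] on; the factor 2 counts the two sites of each level. *)
Lemma core_failure_le (q : nat -> R) g j :
  (forall x k, (P (~` quiet F x k.+1) <= (q k)%:E)%E) ->
  (P (~` core g j) <= (2 * \sum_(k < j * g) q (g + k)%N)%:E)%E.
Proof.
move=> Pq.
have := setC_bigcap_le (sites 0 (j * g))
  (fun x => quiet F x (j.+1 * g - level x)) (fun x => quiet_measurable x _).
move=> /le_trans; apply.
apply: (@le_trans _ _ (\sum_(x <- sites 0 (j * g))
    (q (g + (0 + j * g - (level x).+1))%N)%:E)%E).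
  rewrite big_seq [leRHS]big_seq; apply: lee_sum => x; rewrite mem_sites /= => xlt.
  rewrite (_ : j.+1 * g - level x = (g + (0 + j * g - (level x).+1)).+1)%N.
    exact: Pq.
  lia.
rewrite sumEFin lee_fin big_cat !big_map /=.
have sumE := big_iota_rev _ _ _ 0 (j * g)%N (fun k => q (g + k)%N).
by rewrite !sumE mulr_natl mulr2n.
Qed.

(** On each half-line the shell has one site for each radius from 1 to [g]. By independence each
    half is quiet with probability at least [c], whatever [g] and [j] are. *)
Lemma shell_failure_le (c : R) g j : 0 <= c ->
  (forall (y : nat -> int) n, c <= \prod_(k < n) fine (P (quiet F (y k) k.+1))) ->
  (P (~` shell g j) <= (1 - c ^+ 2)%:E)%E.
Proof.
move=> c0 cle; rewrite probability_setC; last exact: quiet_bigcap_measurable.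
rewrite EFinB leeB// (quiet_independent _ _ (sites_uniq _ _)).
rewrite (eq_bigr (fun x => (fine (P (quiet F x (j.+1 * g - level x))))%:E)); last first.
  by move=> x _; rewrite fineK// fin_num_measure//; exact: quiet_measurable.
rewrite prodEFin lee_fin big_cat !big_map /= expr2.
have half (y : nat -> int) : (forall m, level (y m) = m) -> c <=
    \prod_(m <- iota (j * g) g) fine (P (quiet F (y m) (j.+1 * g - level (y m)))).
  move=> ym; pose h k := fine (P (quiet F (y (j * g + g - k.+1)%N) k.+1)).
  rewrite (eq_big_seq (fun m => h (j * g + g - m.+1)%N)) => [|m]; last first.
    rewrite mem_iota ym /h => /andP[_ mlt].
    rewrite (_ : j * g + g - (j * g + g - m.+1).+1 = m)%N; last by lia.
    by rewrite (_ : j.+1 * g - m = (j * g + g - m.+1).+1)%N //; lia.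
  rewrite (big_iota_rev _ _ _ (j * g) g h).
  exact: (cle (fun k => y (j * g + g - k.+1)%N)).
apply: ler_pM => //; first exact: (half Posz (fun=> erefl)).
exact: (half Negz (fun=> erefl)).
Qed.

(** * Extinction below 1 and survival at 1 *)

(** Survival of a regular realization rules out every barrier: if one of the first [n] shells holds,
    its core must fail. *)
Lemma not_survives_sub g n : (0 < g)%N ->
  survives (F := F) `<=` ~` regular F `|` ((\bigcap_(j in [set` iota 0 n]) ~` shell g j)
    `|` \big[setU/set0]_(j < n) ~` core g j).
Proof.
move=> g0 w surv; have [reg|] := pselect (regular F w); [right|by left].
have [sh|sh] := pselect ((\bigcap_(j in [set` iota 0 n]) ~` shell g j) w).
  by left.
right.
have [j jn shj] : exists2 j, (j < n)%N & shell g j w.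
  apply: contrapT => none; apply: sh => j /=; rewrite mem_iota => /= jn shj.
  by apply: none; exists j.
rewrite -(bigcup_mkord n (fun j => ~` core g j)); exists j => // co.
have := shell_core_barrier g j w (conj shj co).
have : (0 < j.+1 * g)%N by rewrite muln_gt0.
by case: (_ * g)%N => // m _ bar; exact: barrier_extinction reg bar surv.
Qed.

(** For fixed [n], a large [g] makes the [n] core failures negligible, while the bound
    [(1 - c ^+ 2) ^+ n] on the failure of all shells is free of [g]. Only then does [n] tend to
    infinity. *)
Lemma extinction_almost_surely : p%:num < 1 ->
  ('E_Q [fun w => ln (maxn (eta w) 1)%:R] < +oo)%E -> P (survives (F := F)) = 0%E.
Proof.
move=> p1 Efin.
have [M [q [B [q0 qB Mq]]]] : exists (M : nat -> nat) (q : nat -> R) (B : R),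
  [/\ forall k, 0 <= q k, forall n, \sum_(k < n) q k <= B & forall k,
  (Q [set w | (M k <= eta w)%N] + ((M k)%:R * p%:num ^+ k.+1)%:E <= (q k)%:E)%E].
  by apply: logarithmic_moment_summable => //; rewrite p1 andbT.
have Pq x k : (P (~` quiet F x k.+1) <= (q k)%:E)%E.
  exact: le_trans (quiet_fail_le x k.+1 (M k)) (Mq k).
have [delta delta0 Pdelta] := quiet_positive p1.
have [c /andP[c0 c1] cprod] := prod_lower_bound _ _ _ _ q0 qB delta0.
have PE x k : P (quiet F x k) = (fine (P (quiet F x k)))%:E.
  by rewrite fineK// fin_num_measure//; exact: quiet_measurable.
have cle (y : nat -> int) n : c <= \prod_(k < n) fine (P (quiet F (y k) k.+1)).
  apply: (cprod (fun k => fine (P (quiet F (y k) k.+1)))) => k.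
    rewrite -!lee_fin -PE Pdelta probability_le1//; exact: quiet_measurable.
  have := Pq (y k) k; rewrite probability_setC; last exact: quiet_measurable.
  by rewrite PE -EFinB lee_fin lerBlDr lerBlDl addrC.
have mS := survives_measurable F.
have [u uE] : exists u, P (survives (F := F)) = u%:E.
  by exists (fine (P (survives (F := F)))); rewrite fineK// fin_num_measure.
have u0 : 0 <= u by rewrite -lee_fin -uE measure_ge0.
have bound n eps : 0 < eps -> u <= (1 - c ^+ 2) ^+ n + (2 * eps) *+ n.
  move=> eps0; have [K tailK] := uniform_small_tail _ _ _ q0 qB _ eps0.
  pose g := K.+1.
  have [N [mN N0 subN]] := regular_almost_surely p1.
  have PN : P N = 0%E by exact: N0.
  have mshell j : measurable (~` shell g j).
    by apply: measurableC; exact: quiet_bigcap_measurable.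
  have mcore j : measurable (~` core g j).
    by apply: measurableC; exact: quiet_bigcap_measurable.
  pose A := \bigcap_(j in [set` iota 0 n]) ~` shell g j.
  pose C := \big[setU/set0]_(j < n) ~` core g j.
  have mA : measurable A.
    by rewrite /A bigcap_eqseq; apply: big_ind => //; exact: measurableI.
  have mC : measurable C by exact: bigsetU_measurable.
  rewrite -lee_fin -uE; apply: (@le_trans _ _ (P (N `|` (A `|` C)))).
    apply: le_measure; [exact/mem_set|apply/mem_set|].
      by apply: measurableU => //; exact: measurableU.
    by move=> w /(not_survives_sub g n isT) [/subN|h]; [left|right].
  apply: le_trans (probability_setU_le _ _ mN (measurableU _ _ mA mC)) _.
  rewrite PN add0e.
  apply: le_trans (probability_setU_le _ _ mA mC) _; rewrite EFinD; apply: leeD.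
    have PshE j : P (~` shell g j) = (fine (P (~` shell g j)))%:E.
      by rewrite fineK// fin_num_measure.
    have -> : P A = (\prod_(j <- iota 0 n) P (~` shell g j))%E.
      exact: shell_failure_independent.
    rewrite (eq_bigr _ (fun j _ => PshE j)) prodEFin lee_fin.
    have -> : (1 - c ^+ 2) ^+ n = \prod_(j <- iota 0 n) (1 - c ^+ 2).
      by rewrite big_const_seq count_predT size_iota iter_mulr_1.
    apply: ler_prod => j _; rewrite fine_ge0//= -lee_fin -PshE.
    by apply: shell_failure_le => //; exact: ltW.
  have PC : (P C <= \sum_(j < n) P (~` core g j))%E.
    by apply: (@Boole_inequality _ _ _ P (fun j => ~` core g j)).
  apply: le_trans PC _.
  have -> : (2 * eps) *+ n = \sum_(j < n) 2 * eps by rewrite sumr_const card_ord.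
  rewrite -sumEFin; apply: lee_sum => j _.
  apply: le_trans (core_failure_le q g j Pq) _; rewrite lee_fin ler_wpM2l//.
  (* Since [g = K.+1], the sum starts one index after [K]; the extra term [q K] is nonnegative. *)
  apply: (le_trans _ (tailK (j * g).+1)); rewrite big_ord_recl -[leLHS]add0r lerD//.
  by apply: ler_sum => k _; rewrite lift0 addnS.
have small n : u <= (1 - c ^+ 2) ^+ n.
  apply/ler_addgt0Pr => e e0.
  (* With this choice the total error is [e * (n / n.+1)], at most [e]; the successor covers
     [n = 0]. *)
  apply: le_trans (bound n (e / (2 * n.+1%:R)) _) _; first by rewrite divr_gt0.
  rewrite lerD2l -mulr_natr.
  have -> : 2 * (e / (2 * n.+1%:R)) * n%:R = e * (n%:R / n.+1%:R).
    have : n.+1%:R != 0 :> R by rewrite pnatr_eq0.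
    by move: (n.+1%:R) (n%:R) => y z y0; field.
  by rewrite ler_piMr ?(ltW e0)// ler_pdivrMr// mul1r ler_nat.
rewrite uE; congr EFin; apply/eqP; rewrite eq_le u0 andbT.
apply/ler_addgt0Pr => e e0; rewrite add0r.
have norm1 : `|1 - c ^+ 2| < 1.
  by rewrite ger0_norm ?subr_ge0 ?exprn_ile1 ?(ltW c0)// gtrBl exprn_gt0.
have /cvgrPdist_lt /(_ e e0) [n _ /(_ n (leqnn n))] := cvg_expr norm1.
rewrite sub0r normrN => lt; apply: ltW; apply: le_lt_trans lt.
by rewrite (le_trans (small n))// ler_norm.
Qed.

(** If the root is occupied, its first particle is active from time 0 and almost surely never
    dies. *)
Lemma survival_positive : p%:num = 1 -> (0 < Q [set w | (1 <= eta w)%N])%E ->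
  (0 < P (survives (F := F)))%E.
Proof.
move=> p1 Qpos; pose o := graph_root Z_graph.
pose A := fm_count F o @^-1` [set n | (1 <= n)%N].
pose L := fm_life F o 0 @^-1` [set None].
have mA : measurable A by exact: count_measurable.
have mL : measurable L by exact: life_measurable.
have [_ _ lifeN] := fm_lifeP F o 0.
have PL : P L = 1%E by apply: (etrans lifeN); rewrite p1 eqxx.
have PLC : P (~` L) = 0%E by rewrite probability_setC// PL subee.
have mS := survives_measurable F.
have PA : P A = Q [set w | (1 <= eta w)%N] by exact: count_law.
rewrite -PA in Qpos; apply: (lt_le_trans Qpos).
apply: (@le_trans _ _ (P (survives (F := F) `|` ~` L))).
  apply: le_measure; [exact/mem_set|apply/mem_set|].
    by apply: measurableU => //; exact: measurableC.
  move=> w Aw; have [Lw|] := pselect (L w); [left => n|by right].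
  exists o, 0%N; split => //; exists 0%N; split => //.
    exact: activation_time_root.
  by move: Lw; rewrite /L /= => ->.
apply: le_trans (probability_setU_le _ _ mS (measurableC mL)) _.
by rewrite PLC adde0.
Qed.

End probabilities.

Theorem theorem1p1 (R : realType) (d : measure_display)
    (T : measurableType d) (Q : probability T R) (eta : {RV Q >-> nat})
    (FM : forall p : {i01 R}, frog_model Z_graph p eta) :
  (0 < Q [set w | (1 <= eta w)%N])%E ->
  ('E_Q [fun w => ln (maxn (eta w) 1)%:R] < +oo)%E ->
  critical_parameter FM = 1.
Proof.
move=> Qpos Efin; rewrite /critical_parameter.
(* Exactly [p = 1] gives positive survival probability; since [{i01 R}] already carries [p <= 1], it
   remains to exclude [p < 1] and to treat [p = 1]. *)
rewrite (_ : [set _ | _ in _] = [set 1]) ?inf1//.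
apply/seteqP; split => [_ /= [p Ppos <-]|_ /= ->].
  apply/eqP; rewrite eq_le; apply/andP; split=> //.
  rewrite leNgt; apply/negP => p1; move: Ppos.
  by rewrite (extinction_almost_surely (FM p)) ?ltxx.
exists (1%:i01 : {i01 R}) => //=; exact: survival_positive.
Qed.
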